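(* For a positive integer $n$, let $F(n)$ be the number of faces in a random embedding of the complete graph $K_n$. Then: (1) if $n\ge e^{e^{16}}$, then $\mathbb{E}[F(n)]\le 3.65\ln(n)$; (2) if $n\ge e^{30}$, then $\mathbb{E}[F(n)]\le 5\ln(n)$; (3) if $40748\le n<e^{30}$, then $\mathbb{E}[F(n)]\le 10\ln(n)+2$.
   Context: A rotation system of a graph $G$ is a choice, for each vertex $v$, of a cyclic permutation $R_v$ (a single cycle) of the darts at $v$, where a dart is a pair $(v,e)$ with $e$ an edge incident with $v$. Let $R$ be the product of all $R_v$, and let $L$ be the fixed-point-free involution on the set of all darts that swaps the two darts $(u,e),(v,e)$ of each edge $e=uv$. Rotation systems correspond to (equivalence classes of) 2-cell embeddings of a connected graph $G$ in oriented closed surfaces; the faces of the embedding are the cycles of $R\circ L$. A random embedding of $G$ is one given by a rotation system chosen uniformly at random among all $\prod_{v}(\deg(v)-1)!$ rotation systems. *)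

(* Defs.v *)
From HB Require Import structures.
From mathcomp Require Import all_boot all_order all_algebra all_fingroup.
From mathcomp Require Import reals.

Set Implicit Arguments.
Unset Strict Implicit.
Unset Printing Implicit Defensive.

Import GRing.Theory Num.Theory.

Record sgraph := SGraph {
  vertex : finType;
  adj : rel vertex;
  adj_sym : symmetric adj;
  adj_irrefl : irreflexive adj }.

Definition neq_rel (T : eqType) : rel T := fun u v => u != v.

Lemma neq_rel_sym (T : eqType) : symmetric (@neq_rel T).
Proof. by move=> u v; rewrite /neq_rel eq_sym. Qed.

Lemma neq_rel_irrefl (T : eqType) : irreflexive (@neq_rel T).
Proof. by move=> u; rewrite /neq_rel eqxx. Qed.

Definition complete_graph (n : nat) : sgraph :=
  SGraph (@neq_rel_sym 'I_n) (@neq_rel_irrefl 'I_n).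

Section RotationSystems.
Variable G : sgraph.

(* As G is simple, the dart (v, e) with e = vw is encoded by the ordered pair
   (v, w) of adjacent vertices. *)
Definition dart : finType := {d : vertex G * vertex G | adj d.1 d.2}.

Definition darts_at (v : vertex G) : {set dart} :=
  [set d : dart | (val d).1 == v].

Lemma swap_dart_proof (d : dart) : adj (val d).2 (val d).1.
Proof. by rewrite adj_sym; exact: valP d. Qed.

Definition swap_dart (d : dart) : dart :=
  Sub ((val d).2, (val d).1) (swap_dart_proof d).

Lemma swap_dartK : involutive swap_dart.
Proof. by move=> d; apply: val_inj; rewrite /=; case: (val d). Qed.

Definition dart_involution : {perm dart} := perm (inv_inj swap_dartK).

(* R v acts on all darts, fixing those that are not at v. If there is only one
   dart at v, then R v is the identity. *)
Definition is_rotation_system (R : {ffun vertex G -> {perm dart}}) : bool :=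
  [forall v, perm_on (darts_at v) (R v) &&
             [forall d in darts_at v, porbit (R v) d == darts_at v]].

Definition rotation_systems : {set {ffun vertex G -> {perm dart}}} :=
  [set R | is_rotation_system R].

(* The factors have disjoint supports, so their order is irrelevant. *)
Definition rotation_perm (R : {ffun vertex G -> {perm dart}}) : {perm dart} :=
  (\prod_(v : vertex G) R v)%g.

(* (s * t) x = t (s x) for permutations, so the product below is the composite
   of rotation_perm R after dart_involution. porbits includes the fixed
   points. *)
Definition num_faces (R : {ffun vertex G -> {perm dart}}) : nat :=
  #|porbits (dart_involution * rotation_perm R)%g|.

End RotationSystems.

Local Open Scope ring_scope.

Definition uniform_expectation (R : realType) (T : finType) (A : {set T})
    (X : T -> R) : R :=
  (\sum_(x in A) X x) / #|A|%:R.

Definition expected_num_faces (R : realType) (G : sgraph) : R :=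
  uniform_expectation (rotation_systems G) (fun rho => (num_faces rho)%:R).

(* Main.v *)
Require Import Defs.
From HB Require Import structures.
From mathcomp Require Import all_boot all_order all_algebra all_fingroup.
From mathcomp Require Import reals sequences exp.
From mathcomp Require Import zify ring lra.

Set Implicit Arguments.
Unset Strict Implicit.
Unset Printing Implicit Defensive.

Import Order.TTheory GRing.Theory Num.Theory.

(* Trace the face of a dart d = d_0, d_1, d_2, ... while revealing the rotations one value at a
   time. If the vertices are visited at most k times each and have degree at least q + 2k, then
   given the walk so far each dart is the next one with probability at most 1/q: if the next dart
   is e, a switching in the cyclic rotation makes it e' instead, for q choices of e'. Hence
   - the walk first closes up at step i + 2 without visiting a vertex more than k times with
     probability at most 1/q^2, because both its last vertex and then its last dart are forced;
   - 2^(visits to x) grows on average by a factor at most 1 + 1/q per step, so the probability of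
     more than k visits to some vertex within l steps is at most l |V| (1 + 1/q)^l / 2^k.
   The number of faces is the sum over the darts of 1 / (length of the face), so with N darts
   faces longer than l contribute at most N/(l + 1) and the others on average at most
   (N/q^2) (1/2 + ... + 1/(l + 1)), up to the error from too many visits. For K_n with k = n/10,
   q ~ 4n/5 and l ~ N/40 this gives 3.2 ln n + 41. *)

(** * Single cycles on a set and their switchings *)

Definition cyclic_on (T : finType) (D : {set T}) (s : {perm T}) : bool :=
  perm_on D s && [forall d in D, porbit s d == D].

Lemma perm_on_porbit (T : finType) (D : {set T}) (s : {perm T}) x :
  perm_on D s -> porbit s x \subset (if x \in D then D else [set x]).
Proof.
move=> sD; apply/subsetP=> y /porbitP[i ->].
have stab k : (s ^+ k)%g x \in (if x \in D then D else [set x]).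
  elim: k => [|k IHk]; first by rewrite perm1; case: ifP => // _; rewrite inE.
  rewrite expgSr permM; move: IHk; case: ifPn => [_|xD]; first by rewrite (perm_closed _ sD).
  by rewrite !inE => /eqP->; rewrite (out_perm sD).
exact: stab.
Qed.

Lemma card_porbits_perm_on (T : finType) (D : {set T}) (s : {perm T}) :
  perm_on D s -> #|porbits s| = #|porbit s @: D| + #|~: D|.
Proof.
move=> sD.
have out x : x \notin D -> porbit s x = [set x].
  move=> xD; apply/eqP; rewrite eqEsubset sub1set porbit_id andbT.
  by have := perm_on_porbit x sD; rewrite (negbTE xD).
have -> : porbits s = porbit s @: D :|: set1 @: (~: D).
  rewrite -(eq_in_imset (f := porbit s)); last by move=> x; rewrite inE; exact: out.
  by rewrite -imsetU setUCr; apply/setP=> X; apply/imsetP/imsetP => -[x _ ->];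
     exists x; rewrite ?inE.
rewrite cardsU (card_imset _ set1_inj) -[RHS]subn0; congr (_ - _).
apply/eqP; rewrite cards_eq0; apply/eqP/setP=> X; rewrite !inE.
apply/negbTE/negP => /andP[/imsetP[x xD ->] /imsetP[y]].
rewrite inE => yD /setP/(_ x); rewrite porbit_id inE => /esym/eqP xy.
by rewrite -xy xD in yD.
Qed.

(** Points outside [D] are fixed, so being one cycle on [D] becomes a count of orbits, which can be
    followed through products with transpositions. *)
Lemma cyclic_onE (T : finType) (D : {set T}) (s : {perm T}) c :
  c \in D -> cyclic_on D s = perm_on D s && (#|porbits s| == #|~: D|.+1).
Proof.
move=> cD; rewrite /cyclic_on; case: (boolP (perm_on D s)) => //= sD.
rewrite (card_porbits_perm_on sD) -[X in _ == X]add1n eqn_add2r.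
apply/idP/idP => [/forall_inP orb|/cards1P[C orbC]].
  apply/cards1P; exists D; apply/setP=> X; rewrite inE; apply/imsetP/eqP.
    by case=> x xD ->; apply/eqP/orb.
  by move=> ->; exists c => //; apply/esym/eqP/orb.
have orb x : x \in D -> porbit s x = C.
  by move=> xD; apply/set1P; rewrite -orbC imset_f.
apply/forall_inP => x xD; rewrite eqEsubset.
have := perm_on_porbit x sD; rewrite xD => -> /=.
by apply/subsetP=> y yD; rewrite (orb _ xD) -(orb _ yD) porbit_id.
Qed.

Lemma cyclic_on_porbit (T : finType) (D : {set T}) (s : {perm T}) x y :
  cyclic_on D s -> x \in D -> (y \in porbit s x) = (y \in D).
Proof. by case/andP=> _ /forall_inP orb /orb/eqP->. Qed.

Lemma porbits_tperm_mul (T : finType) (s : {perm T}) x y :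
  #|porbits (s * tperm x y)%g| + (x \notin porbit s y).*2
  = #|porbits s| + (x != y).
Proof.
have := porbits_mul_tperm s^-1 x y; rewrite /= porbitsV porbitV => <-.
by rewrite -porbitsV invMg tpermV.
Qed.

(* In the cycle notation (c e .. f A e' B) becomes (c e' A e .. f B): the segment from e to f
   and the point e' trade places. *)
Lemma cyclic_on_switch (T : finType) (D : {set T}) (s : {perm T}) e f e' m :
  cyclic_on D s -> e \in D -> e' \in D -> e' != e ->
  f = (s ^+ m)%g e -> (forall j, j < m -> (s ^+ j)%g e \notin [set f; e']) ->
  f != e' -> cyclic_on D (tperm f e' * s * tperm e e')%g.
Proof.
move=> sD eD e'D e'e fE chain fe'.
have fD : f \in D by rewrite -(cyclic_on_porbit f sD eD) fE mem_porbit.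
have onD := (andP sD).1.
have t_on x y : x \in D -> y \in D -> perm_on D (tperm x y).
  move=> xD yD; apply: subset_trans (tperm_on x y) _.
  by apply/subsetP=> z; rewrite !inE => /orP[]/eqP->.
rewrite (cyclic_onE _ eD) !perm_onM ?t_on //=.
(* [s1] splits the cycle in two, one part through [e] and [f] and one through [e']; the last factor
   [tperm e e'] merges them again. *)
set s1 := (tperm f e' * s)%g.
have chain1 j : j <= m -> (s1 ^+ j)%g e = (s ^+ j)%g e.
  elim: j => [|j IHj] jm; first by rewrite !expg0.
  rewrite !expgSr !permM IHj 1?ltnW// tpermD //.
    by have := chain _ jm; rewrite !inE negb_or => /andP[]; rewrite eq_sym.
  by have := chain _ jm; rewrite !inE negb_or => /andP[_]; rewrite eq_sym.
have ef1 : f \in porbit s1 e by rewrite fE -chain1 // mem_porbit.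
have split1 := porbits_mul_tperm s f e'; have split2 := porbits_mul_tperm s1 f e'.
move: split1 split2.
rewrite /= /s1 mulgA tperm2 mul1g -/s1 (cyclic_on_porbit _ sD e'D) fD fe' addn0 /=.
move=> split1 split2.
have fe'1 : f \notin porbit s1 e'.
  by move: split2; rewrite split1; case: (f \notin _) => //=; lia.
have ee'1 : e \notin porbit s1 e'.
  by move: fe'1; apply: contra; rewrite -eq_porbit_mem => /eqP<-.
have := porbits_tperm_mul s1 e e'; rewrite ee'1 eq_sym e'e split1 /= -addnA.
move/eqP; rewrite eqn_add2r => /eqP->.
by move: sD; rewrite (cyclic_onE _ eD) onD.
Qed.

(** [I] holds the points whose images are already revealed. The multipliers [a] and [b] are chosen
    before [s], so one injective map serves every [s] compatible with the revealed values. Keeping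
    [e'] out of [I] and [s0 @: I] leaves those values intact. *)
Lemma cyclic_on_redirect (T : finType) (D I : {set T}) (s0 : {perm T}) c e e' :
  cyclic_on D s0 -> c \in D -> c \notin I -> s0 c = e ->
  e' \in D -> e' \notin I :|: s0 @: I :|: [set c; e] ->
  exists a b : {perm T}, forall s,
    cyclic_on D s -> s c = e -> {in I, s =1 s0} ->
    [/\ cyclic_on D (a * s * b)%g, (a * s * b)%g c = e'
      & {in I, (a * s * b)%g =1 s0}].
Proof.
move=> s0D cD cI s0c e'D; rewrite !inE !negb_or -!andbA => /and4P[e'I e'O e'c e'e].
have eD : e \in D by rewrite -s0c perm_closed //; case/andP: s0D.
(* [f] will be the first point from [e] on whose image is not revealed, so the segment from [e] to
   [f] is common to all [s]. *)
have exm : exists j, (s0 ^+ j)%g e \notin I.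
  by have := cD; rewrite -(cyclic_on_porbit c s0D eD) => /porbitP[j cE]; exists j; rewrite -cE.
pose m := ex_minn exm; pose f := (s0 ^+ m)%g e.
have fI : f \notin I by rewrite /f /m; case: ex_minnP.
have mI j : j < m -> (s0 ^+ j)%g e \in I.
  rewrite /m; case: ex_minnP => k _ kmin jk; apply/negPn/negP => /kmin.
  by rewrite leqNgt jk.
have fe' : f != e'.
  rewrite /f; case: (posnP m) => [->|m0]; first by rewrite expg0 perm1 eq_sym.
  rewrite -(prednK m0) expgSr permM; apply: contra e'O => /eqP<-.
  by rewrite imset_f // mI // prednK.
have chain (s : {perm T}) : {in I, s =1 s0} -> forall j, j <= m -> (s ^+ j)%g e = (s0 ^+ j)%g e.
  move=> sI; elim=> [|j IHj] jm; first by rewrite !expg0.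
  by rewrite !expgSr !permM IHj 1?ltnW // sI // mI.
(* If the chain from e ended at c, it would be all of D and leave no room for e'. *)
have fc : f != c.
  apply/eqP=> fcE; have := e'D; rewrite -(cyclic_on_porbit e' s0D eD) => /porbitP[j e'E].
  have bound k : exists2 i, i <= m & (s0 ^+ k)%g e = (s0 ^+ i)%g e.
    elim: k => [|k [i im kE]]; first by exists 0.
    move: im; rewrite leq_eqVlt => /orP[/eqP im|im].
      by exists 0 => //; rewrite expgSr permM kE im -/f fcE s0c expg0 perm1.
    by exists i.+1 => //; rewrite !expgSr !permM kE.
  have [[|i] im iE] := bound j; move: e'E; rewrite iE => e'E.
    by rewrite e'E expg0 perm1 eqxx in e'e.
  by move: e'O; rewrite e'E expgSr permM imset_f // mI.
exists (tperm f e'), (tperm e e') => s sD sc sI.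
split.
- apply: (cyclic_on_switch (m := m)) => //; first by rewrite chain.
  move=> j jm; rewrite chain 1?ltnW // !inE negb_or; apply/andP; split.
    by apply: contra fI => /eqP<-; exact: mI.
  by apply: contra e'I => /eqP<-; exact: mI.
- by rewrite !permM (tpermD fc e'c) sc tpermL.
- move=> a aI; rewrite !permM [tperm f e' a]tpermD; first last.
  + by apply: contra e'I => /eqP->.
  + by apply: contra fI => /eqP->.
  rewrite sI // tpermD //; last by apply: contra e'O => /eqP->; exact: imset_f.
  apply/eqP=> ea; have ca : c = a by apply: (@perm_inj _ s0); rewrite s0c.
  by rewrite -ca (negbTE cI) in aI.
Qed.

(** * Face walks and the probability of the next dart *)

Section FaceWalks.
Variable G : sgraph.
Implicit Types (rho : {ffun vertex G -> {perm dart G}}) (d e c a : dart G).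
Implicit Types (x v : vertex G) (p : seq (dart G)).

Definition src d : vertex G := (val d).1.
Definition tgt d : vertex G := (val d).2.
Definition face_perm rho : {perm dart G} :=
  (dart_involution G * rotation_perm rho)%g.

(** The list is d_0, ..., d_i; producing it consults the rotation at the target of each dart but the
    last. *)
Definition walk rho d i : seq (dart G) := traject (face_perm rho) d i.+1.
Arguments walk : simpl never.

Definition visits x p : nat := count (fun a => tgt a == x) p.

Lemma last_walk rho d i : last d (walk rho d i) = iter i (face_perm rho) d.
Proof. by rewrite /walk trajectS /= last_traject. Qed.

Lemma dart_inj d e : src d = src e -> tgt d = tgt e -> d = e.
Proof.
by rewrite /src /tgt => tE hE; apply: val_inj; rewrite (surjective_pairing (val d))
  (surjective_pairing (val e)) tE hE.
Qed.

Lemma tgt_neq_src d : tgt d != src d.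
Proof.
by apply/eqP; rewrite /tgt /src; have := valP d; case: (val d) => a b /= ab ba;
  rewrite ba adj_irrefl in ab.
Qed.

Lemma in_rotation_systems rho :
  reflect (forall v, cyclic_on (darts_at v) (rho v)) (rho \in rotation_systems G).
Proof. by rewrite inE; exact: forallP. Qed.

(** The factors other than the one at [src c] fix both [c] and its image, which has the same
    source. *)
Lemma rotation_permE rho c :
  rho \in rotation_systems G -> rotation_perm rho c = rho (src c) c.
Proof.
move/in_rotation_systems=> rhoP.
have off v a : v != src a -> rho v a = a.
  move=> va; apply: (out_perm (andP (rhoP v)).1).
  by rewrite inE eq_sym.
have on v a : src (rho v a) = src a.
  have [va|/off-> //] := eqVneq v (src a).
  have : rho v a \in darts_at v by rewrite (perm_closed _ (andP (rhoP v)).1) inE va.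
  by rewrite inE -va => /eqP.
rewrite /rotation_perm.
have : uniq (index_enum (vertex G)) by exact: index_enum_uniq.
have := mem_index_enum (src c); move: (index_enum _) => r.
elim: r => [|v r IHr] //=; rewrite inE big_cons permM => /orP[/eqP <-|cr] /andP[vr ur].
  have fix_ a : src a \notin r -> (\prod_(w <- r) rho w)%g a = a.
    elim: r {IHr vr ur} => [|w r IHr] ar; first by rewrite big_nil perm1.
    move: ar; rewrite inE negb_or big_cons permM => /andP[aw ar].
    by rewrite off 1?eq_sym // IHr.
  by rewrite fix_ // on.
by rewrite off ?IHr //; apply: contraNneq vr => ->.
Qed.

Lemma face_permE rho d :
  rho \in rotation_systems G -> face_perm rho d = rho (tgt d) (swap_dart d).
Proof. by move=> rhoP; rewrite permM permE rotation_permE. Qed.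

Lemma src_face_perm rho d :
  rho \in rotation_systems G -> src (face_perm rho d) = tgt d.
Proof.
move=> rhoP; rewrite face_permE //.
have [onD _] := andP (in_rotation_systems _ rhoP (tgt d)).
have : rho (tgt d) (swap_dart d) \in darts_at (tgt d).
  by rewrite (perm_closed _ onD) inE.
by rewrite inE => /eqP.
Qed.

Lemma eq_walk rho rho' d i :
  {in traject (face_perm rho) d i, face_perm rho' =1 face_perm rho} ->
  walk rho' d i = walk rho d i.
Proof.
rewrite /walk; elim: i => // i IHi eq_f.
have eq_f' : {in traject (face_perm rho) d i, face_perm rho' =1 face_perm rho}.
  by move=> a ai; apply: eq_f; rewrite trajectSr mem_rcons inE ai orbT.
have IH := IHi eq_f'; rewrite !(trajectSr _ _ i.+1) IH; congr rcons.
rewrite !iterS; move: IH; rewrite !trajectSr => /rcons_inj[_ ->].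
by apply: eq_f; rewrite trajectSr mem_rcons mem_head.
Qed.

Lemma walk_eq_in rho rho' d i :
  walk rho' d i = walk rho d i ->
  {in traject (face_perm rho) d i, face_perm rho' =1 face_perm rho}.
Proof.
move=> eq_w a /trajectP[j ji ->].
have nthE k : k <= i -> iter k (face_perm rho') d = iter k (face_perm rho) d.
  by move=> ki; have := congr1 (nth d ^~ k) eq_w; rewrite /walk !nth_traject.
by rewrite -{1}nthE 1?ltnW // -!iterS nthE.
Qed.

(** For each admissible dart [e'] at the current vertex, redirecting maps the rotation systems with
    next dart [e] injectively to those with the same walk and next dart [e']. The images for
    different [e'] are disjoint, and each visit rules out at most two darts. *)
Lemma card_fiber_step d i p e :
  uniq p ->
  #|[set rho in rotation_systems G | walk rho d i == p &
       face_perm rho (last d p) == e]| *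
    (#|darts_at (tgt (last d p))| - 2 * visits (tgt (last d p)) p)
  <= #|[set rho in rotation_systems G | walk rho d i == p]|.
Proof.
move=> up; set x := tgt (last d p); set Ae := [set rho in _ | _ & _]; set A := [set rho in _ | _].
have [->|[rho0]] := set_0Vmem Ae; first by rewrite cards0.
rewrite !inE => /and3P[rot0 /eqP walk0 /eqP next0].
pose c := swap_dart (last d p); pose s0 := rho0 x.
have pE : p = rcons (traject (face_perm rho0) d i) (last d p).
  rewrite -{1}walk0 /walk trajectSr; congr rcons.
  by rewrite -walk0 last_walk.
set t := traject (face_perm rho0) d i in pE.
pose I := [set swap_dart a | a in [set a in t | tgt a == x]].
have rot0' : rho0 \in rotation_systems G by rewrite inE.
have cyc v : cyclic_on (darts_at v) (rho0 v) by exact: in_rotation_systems.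
have s0c : s0 c = e by rewrite -next0 face_permE.
have cD : c \in darts_at x by rewrite inE.
have cI : c \notin I.
  apply/imsetP=> -[a]; rewrite !inE => /andP[at_ _] /(can_inj (@swap_dartK G)) ca.
  by move: up; rewrite pE rcons_uniq ca at_.
(* The last dart of [p] counts as a visit to [x] but its rotation value is still hidden; this spare
   visit pays for [c] and [e] in [F]. *)
have cardI : #|I|.+1 <= visits x p.
  rewrite pE /visits -cats1 count_cat /= eqxx addn1 ltnS.
  rewrite card_imset; last exact: (can_inj (@swap_dartK G)).
  rewrite -size_filter; apply: leq_trans (card_size _).
  by apply: subset_leq_card; apply/subsetP=> a; rewrite !inE mem_filter andbC.
pose F := I :|: s0 @: I :|: [set c; e].
have cardF : #|F| <= 2 * visits x p.
  apply: leq_trans (_ : #|I| + #|I| + 2 <= _); last by lia.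
  apply: leq_trans (leq_card_setU _ _) _; apply: leq_add; last by rewrite cards2; case: eqP.
  apply: leq_trans (leq_card_setU _ _) _; apply: leq_add => //.
  exact: leq_imset_card.
pose V := darts_at x :\: F.
have cardV : #|darts_at x| - 2 * visits x p <= #|V|.
  rewrite cardsD; apply: leq_sub2l.
  by apply: leq_trans cardF; apply: subset_leq_card; exact: subsetIr.
pose next rho := face_perm rho (last d p).
suff inj_next e' : e' \in V -> #|Ae| <= #|[set rho in A | next rho == e']|.
  apply: leq_trans (_ : \sum_(e' in V) #|[set rho in A | next rho == e']| <= _).
    rewrite mulnC; apply: leq_trans (leq_mul cardV (leqnn _)) _.
    by rewrite -sum_nat_const; apply: leq_sum => e'; exact: inj_next.
  rewrite -sum1_card (partition_big next xpredT) //= big_mkcond /=.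
  apply: leq_sum => e' _; case: ifP => // _.
  by rewrite -sum1_card; apply/eq_leq/eq_bigl => rho; rewrite !inE.
rewrite inE => /andP[e'F e'D].
have [l [r redirect]] := cyclic_on_redirect (cyc x) cD cI s0c e'D e'F.
pose g rho := [ffun v => if v == x then (l * rho v * r)%g else rho v].
have g_inj : injective g.
  move=> rho rho' /ffunP eq_g; apply/ffunP=> v; have := eq_g v; rewrite !ffunE.
  by case: ifP => // _ /mulIg/mulgI.
rewrite -(card_imset _ g_inj); apply: subset_leq_card.
apply/subsetP=> _ /imsetP[rho rhoAe ->]; move: rhoAe; rewrite inE => /and3P[rot /eqP walkE /eqP nextE].
have rhoI : {in I, rho x =1 s0}.
  move=> _ /imsetP[a /[!inE] /andP[at_ /eqP ax] ->].
  rewrite -ax /s0 -ax -!face_permE //.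
  exact: walk_eq_in (etrans walkE (esym walk0)) _ at_.
have rc : rho x c = e by rewrite -nextE face_permE.
have [gcyc gc gI] := redirect _ (in_rotation_systems _ rot x) rc rhoI.
have grot : g rho \in rotation_systems G.
  apply/in_rotation_systems => v; rewrite ffunE; case: eqP => [->|_] //.
  exact: in_rotation_systems.
rewrite !inE; rewrite inE in grot; rewrite grot /next face_permE ?inE // ffunE eqxx gc eqxx andbT /=.
rewrite -walk0; apply/eqP/eq_walk => a at_; rewrite !face_permE ?inE // ffunE.
case: eqP => [ax|ax].
  by rewrite ax gI //; apply/imsetP; exists a => //; rewrite inE at_ ax eqxx.
rewrite -!face_permE //.
exact: walk_eq_in (etrans walkE (esym walk0)) _ at_.
Qed.

(** This sums the preceding count over all walks in [S], weighted by [f]. The next dart starts at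
    the target of the last one, so [h] admits at most one candidate. *)
Lemma walk_step d i q (S : pred (seq (dart G))) (f : seq (dart G) -> nat)
    (h : seq (dart G) -> pred (dart G)) :
  (forall p, S p -> uniq p /\
     q + 2 * visits (tgt (last d p)) p <= #|darts_at (tgt (last d p))|) ->
  (forall p e e', src e = src e' -> h p e -> h p e' -> e = e') ->
  q * \sum_(rho in rotation_systems G | S (walk rho d i) &&
              h (walk rho d i) (iter i.+1 (face_perm rho) d)) f (walk rho d i)
  <= \sum_(rho in rotation_systems G | S (walk rho d i)) f (walk rho d i).
Proof.
move=> SP hP.
have szw rho : size (walk rho d i) == i.+1 by rewrite size_traject.
pose w rho : i.+1.-tuple (dart G) := Tuple (szw rho).
rewrite (partition_big w xpredT) //= [X in _ <= X](partition_big w xpredT) //=.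
rewrite big_distrr /=; apply: leq_sum => p _.
have wE rho : (w rho == p) = (walk rho d i == p) by [].
under eq_bigr => rho /andP[_ /eqP wp] do rewrite -[walk rho d i]/(val (w rho)) wp.
under [X in _ <= X]eq_bigr => rho /andP[_ /eqP wp] do rewrite -[walk rho d i]/(val (w rho)) wp.
rewrite !sum_nat_cond_const mulnA leq_mul2r; apply/orP; right.
have [Sp|nSp] := boolP (S p); last first.
  rewrite (_ : #|_| = 0) ?muln0 //; apply: eq_card0 => rho; rewrite !inE wE.
  by apply/negbTE; apply: contra nSp => /andP[/and3P[_ Sw _] /eqP <-].
have [up room] := SP p Sp.
set x := tgt (last d p) in room.
case: (pickP [pred rho | [&& rho \in rotation_systems G, walk rho d i == p
                          & h p (face_perm rho (last d p))]]) => [rho0 /and3P[rot0 _ h0]|none].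
  have := card_fiber_step d i (face_perm rho0 (last d p)) up; rewrite -/x mulnC.
  move=> le_step; apply: leq_trans (leq_trans _ le_step) _.
    apply: leq_mul; first by lia.
    apply/subset_leq_card/subsetP => rho; rewrite !inE wE.
    move=> /andP[/and3P[rot Sw hw] /eqP wp]; rewrite rot wp eqxx /=; apply/eqP.
    rewrite -last_walk wp in hw; apply: (hP p _ _ _ hw h0).
    by rewrite !src_face_perm // inE.
  apply/subset_leq_card/subsetP => rho; rewrite !inE wE.
  by move=> /andP[-> /eqP ->]; rewrite Sp eqxx.
rewrite (_ : #|_| = 0) ?muln0 //; apply: eq_card0 => rho; rewrite !inE wE.
apply/negbTE/negP => /andP[/and3P[rot Sw hw] /eqP wp].
by have := none rho; rewrite /= inE rot wp eqxx -[in last d _]wp last_walk -wp hw.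
Qed.
End FaceWalks.

(** * Walks without repeated darts and with at most [k] visits per vertex *)

Section TameWalks.
Variables (G : sgraph) (k q : nat).
Hypothesis min_degree : forall x : vertex G, q + 2 * k <= #|darts_at x|.
Implicit Types (rho : {ffun vertex G -> {perm dart G}}) (d : dart G).
Implicit Types (x : vertex G) (p : seq (dart G)).

Definition tame p : bool := uniq p && [forall x, visits x p <= k].

Lemma walk_rcons rho d i :
  walk rho d i.+1 = rcons (walk rho d i) (iter i.+1 (face_perm rho) d).
Proof. exact: trajectSr. Qed.

Lemma visits_walkS x rho d i :
  visits x (walk rho d i.+1)
  = visits x (walk rho d i) + (tgt (iter i.+1 (face_perm rho) d) == x).
Proof. by rewrite walk_rcons /visits -cats1 count_cat /= addn0. Qed.

Lemma tame_walkW rho d i : tame (walk rho d i.+1) -> tame (walk rho d i).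
Proof.
case/andP=> u /forallP v; apply/andP; split.
  by move: u; rewrite walk_rcons rcons_uniq => /andP[].
by apply/forallP=> x; apply: leq_trans (v x); rewrite visits_walkS leq_addr.
Qed.

Lemma tame_room d p : tame p ->
  uniq p /\ q + 2 * visits (tgt (last d p)) p <= #|darts_at (tgt (last d p))|.
Proof.
case/andP=> up /forallP vp; split=> //; apply: leq_trans (min_degree _).
by rewrite leq_add2l leq_mul2l vp orbT.
Qed.

Arguments tame_room d [p].

(** Two uses of [walk_step]: d_{i+1} must end at the source of [d], then d_{i+2} must be [d]. The
    weight [f] carries the first event into the second. *)
Lemma card_closed_tame_walks d i :
  q ^ 2 * #|[set rho in rotation_systems G | tame (walk rho d i.+1) &
                iter i.+2 (face_perm rho) d == d]| <= #|rotation_systems G|.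
Proof.
pose f p : nat := tgt (last d p) == src d.
have close := @walk_step G d i.+1 q tame f (fun=> pred1 d) (tame_room d).
have reach := @walk_step G d i q tame (fun=> 1) (fun=> [pred e | tgt e == src d])
  (tame_room d).
have {reach} := reach (fun p e e' sE tE tE' => dart_inj sE (etrans (eqP tE) (esym (eqP tE')))).
have {close} := close (fun p e e' _ dE dE' => etrans (eqP dE) (esym (eqP dE'))).
set closed := \sum_(rho in _ | _) _; set reached := \sum_(rho in _ | _) _ => le_close.
set start := \sum_(rho in _ | _) _; set arrived := \sum_(rho in _ | _) _ => le_reach.
have le_arrived : arrived <= #|rotation_systems G|.
  rewrite /arrived sum1_card; apply/subset_leq_card/subsetP=> rho.
  by rewrite unfold_in => /andP[].
have -> : #|[set rho in rotation_systems G | tame (walk rho d i.+1) &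
                iter i.+2 (face_perm rho) d == d]| = closed.
  rewrite -sum1_card /closed; apply: eq_big => rho; first by rewrite inE -andbA.
  rewrite inE => /and3P[rot _ /eqP dE].
  by rewrite /f last_walk -(src_face_perm _ rot) -iterS dE eqxx.
rewrite expnS expn1 -mulnA; apply: leq_trans le_arrived; apply: leq_trans le_reach.
rewrite leq_mul2l; apply/orP; right; apply: leq_trans le_close _.
rewrite /reached /start big_mkcond [X in _ <= X]big_mkcond; apply: leq_sum => rho _.
case: andP => // -[rot tm]; rewrite rot (tame_walkW tm) /f last_walk /=.
by case: (_ == _).
Qed.

(** A step doubles the weight if it ends at [x], with conditional probability at most 1/q, and keeps
    it otherwise: a factor (q+1)/q. The leading 2 is for [d], which may itself end at [x]. *)
Lemma sum_exp_visits x d i :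
  q ^ i.+1 * \sum_(rho in rotation_systems G | tame (walk rho d i))
     2 ^ visits x (walk rho d i.+1) <= 2 * q.+1 ^ i.+1 * #|rotation_systems G|.
Proof.
pose M j := \sum_(rho in rotation_systems G | tame (walk rho d j)) 2 ^ visits x (walk rho d j).
have step j : q * \sum_(rho in rotation_systems G | tame (walk rho d j))
     2 ^ visits x (walk rho d j.+1) <= q.+1 * M j.
  have := @walk_step G d j q tame (fun p => 2 ^ visits x p) (fun=> [pred e | tgt e == x])
    (tame_room d).
  rewrite -/(M j) => /(_ _) reach.
  rewrite (eq_bigr (fun rho => 2 ^ visits x (walk rho d j) +
     (if tgt (iter j.+1 (face_perm rho) d) == x then 2 ^ visits x (walk rho d j) else 0))).
    rewrite big_split -big_mkcondr /= -/(M j) mulnDr mulSn addnC leq_add2r.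
    under eq_bigl => rho do rewrite -andbA.
    by apply: reach => p e e' tE /eqP hE /eqP hE'; apply: dart_inj; rewrite ?hE.
  move=> rho _; rewrite visits_walkS; case: eqP => _; last by rewrite !addn0.
  by rewrite addn1 expnS mul2n addnn.
elim: i => [|i IHi].
  rewrite !expn1; apply: leq_trans (step 0) _; rewrite [2 * _]mulnC -mulnA leq_mul2l /=.
  rewrite mulnC -sum_nat_const /M big_mkcondr; apply: leq_sum => rho _.
  by rewrite /walk /= /visits /=; case: ifP => // _; case: (_ == _).
rewrite expnSr -mulnA; apply: leq_trans (leq_mul (leqnn _) (step _)) _.
rewrite [q.+1 ^ i.+2]expnS [2 * _]mulnCA -mulnA mulnCA leq_mul2l /=; apply: leq_trans IHi.
rewrite leq_mul2l; apply/orP; right.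
rewrite /M big_mkcond [X in _ <= X]big_mkcond; apply: leq_sum => rho _.
by case: andP => // -[rot tm]; rewrite rot (tame_walkW tm).
Qed.

(** Markov's inequality for the weight 2^visits, with a union bound over the vertices. *)
Lemma card_wild_walks d i :
  2 ^ k * q ^ i.+1 *
  #|[set rho in rotation_systems G | tame (walk rho d i) &
       [exists x, k < visits x (walk rho d i.+1)]]|
  <= #|vertex G| * q.+1 ^ i.+1 * #|rotation_systems G|.
Proof.
set W := [set rho in _ | _ & _].
(* More than [k] visits give weight at least 2^(k+1); the extra 2 cancels the one in
   [sum_exp_visits]. *)
rewrite -(leq_pmul2l (m := 2)) //.
apply: leq_trans (_ : q ^ i.+1 * \sum_(x : vertex G) \sum_(rho in W) 2 ^ visits x (walk rho d i.+1) <= _).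
  rewrite !mulnA -expnS -mulnA mulnCA leq_mul2l; apply/orP; right.
  rewrite mulnC -sum_nat_const exchange_big /=; apply: leq_sum => rho.
  rewrite inE => /and3P[_ _ /existsP[x kx]]; rewrite (bigD1 x) //=.
  by apply: leq_trans (leq_addr _ _); rewrite leq_exp2l.
have -> : 2 * (#|vertex G| * q.+1 ^ i.+1 * #|rotation_systems G|)
    = \sum_(x : vertex G) 2 * q.+1 ^ i.+1 * #|rotation_systems G|.
  by rewrite sum_nat_const -!mulnA mulnCA.
rewrite big_distrr /=.
apply: leq_sum => x _; apply: leq_trans (sum_exp_visits x d i).
rewrite leq_mul2l; apply/orP; right.
rewrite big_mkcond [X in _ <= X]big_mkcond; apply: leq_sum => rho _.
by rewrite inE; case: (rho \in _) => //=; case: (tame _) => //=; case: ifP.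
Qed.
End TameWalks.

(** * From counts of walks to the expected number of faces *)

Local Open Scope ring_scope.

Lemma card_porbits_sum (R : numFieldType) (T : finType) (s : {perm T}) :
  #|porbits s|%:R = \sum_(x : T) (#|porbit s x|%:R)^-1 :> R.
Proof.
rewrite (partition_big_imset (porbit s)) /= -/(porbits s) -sum1_card natr_sum.
apply: eq_big => [C|_ /imsetP[x _ ->]].
  by apply/imsetP/imsetP => -[x _ ->]; exists x.
rewrite (eq_bigr (fun=> (#|porbit s x|%:R)^-1)); last by move=> y /eqP->.
rewrite sumr_const; have -> : #|[pred y | porbit s y == porbit s x]| = #|porbit s x|.
  by apply: eq_card => y; rewrite [LHS]inE /= eq_porbit_mem.
by rewrite -[RHS]mulr_natl divff // pnatr_eq0 card_porbit_neq0.
Qed.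

Section ShortFaces.
Variables (R : realType) (G : sgraph) (k q l : nat).
Hypotheses (k_gt0 : (0 < k)%N) (q_gt0 : (0 < q)%N).
Hypothesis min_degree : forall x : vertex G, (q + 2 * k <= #|darts_at x|)%N.

Let closed (rho : {ffun vertex G -> {perm dart G}}) d i : bool :=
  tame k (walk rho d i.+1) && (iter i.+2 (face_perm rho) d == d).
Let wild (rho : {ffun vertex G -> {perm dart G}}) d i : bool :=
  tame k (walk rho d i) && [exists x, (k < visits x (walk rho d i.+1))%N].

(** Either the face is longer than [l], or its walk stays tame and closes at its length, or tameness
    is lost earlier, where the crude bound 1 is used. *)
Lemma inv_face_length rho d : rho \in rotation_systems G ->
  (#|porbit (face_perm rho) d|%:R)^-1 <=
  l.+1%:R^-1 + \sum_(i < l) (i.+2%:R^-1 * (closed rho d i)%:R) + \sum_(i < l) (wild rho d i)%:R :> R.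
Proof.
move=> rot; set L := #|porbit _ _|.
have closed_ge0 : 0 <= \sum_(i < l) (i.+2%:R^-1 * (closed rho d i)%:R) :> R.
  by apply: sumr_ge0 => i _; rewrite mulr_ge0 ?invr_ge0.
have wild_ge0 : 0 <= \sum_(i < l) (wild rho d i)%:R :> R by exact: sumr_ge0.
have L_gt0 : (0 < L)%N by rewrite lt0n card_porbit_neq0.
have [lL|Ll] := ltnP l L.
  do 2!apply: ler_wpDr => //; rewrite lef_pV2 ?posrE ?ltr0n // ler_nat //.
have uL := uniq_traject_porbit (face_perm rho) d.
have loopL := iter_porbit (face_perm rho) d.
rewrite -/L in uL loopL.
(* Length 1 is impossible: a dart never ends at its own source. *)
case LE : L L_gt0 => [|[|i]] // _; rewrite LE in uL loopL Ll.
  by have := tgt_neq_src d; rewrite -(src_face_perm d rot) -[face_perm rho d]/(iter 1 _ d) loopL eqxx.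
have il : (i < l)%N by apply: ltn_trans Ll.
have [tm|ntm] := boolP (tame k (walk rho d i.+1)).
  apply: ler_wpDr => //; apply: ler_wpDl; first by rewrite invr_ge0.
  rewrite (bigD1 (Ordinal il)) //=.
  rewrite /closed tm loopL eqxx mulr1 lerDl.
  by apply: sumr_ge0 => j _; rewrite mulr_ge0 ?invr_ge0.
(* Before the face closes no dart repeats, so the first failure of tameness is an excess of
   visits. *)
have [j ntj jmin] := ex_minnP (ex_intro (fun j => ~~ tame k (walk rho d j)) _ ntm).
have ji : (j <= i.+1)%N by exact: jmin.
have u j' : (j' <= i.+1)%N -> uniq (walk rho d j').
  by move=> j'i; rewrite /walk -(@take_traject _ _ i.+2) // take_uniq.
have many : [exists x, (k < visits x (walk rho d j))%N].
  by move: ntj; rewrite /tame u //= negb_forall; under eq_existsb => x do rewrite -ltnNge.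
case: j ntj jmin ji many => [|j] ntj jmin ji many.
  case/existsP: many => x; rewrite ltnNge => /negP[].
  by apply: leq_trans k_gt0; rewrite /walk /= /visits /=; case: (_ == _).
have tmj : tame k (walk rho d j).
  by apply: contraT => /jmin; rewrite ltnn.
have jl : (j < l)%N by lia.
apply: ler_wpDl; first by rewrite addr_ge0 ?invr_ge0.
rewrite (bigD1 (Ordinal jl)) //= /wild tmj many /=.
apply: le_trans (_ : 1 <= _); first by rewrite invf_le1 ?ler1n ?ltr0n.
by rewrite lerDl sumr_ge0.
Qed.

Lemma expected_num_faces_le :
  expected_num_faces R G <=
  #|dart G|%:R * (l.+1%:R^-1 + (\sum_(i < l) i.+2%:R^-1) / q%:R ^+ 2 +
    l%:R * #|vertex G|%:R * (1 + q%:R^-1) ^+ l / 2 ^+ k).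
Proof.
rewrite /expected_num_faces /uniform_expectation.
(* With no rotation systems the quotient is 0, since 0 has inverse 0, and the bound is
   nonnegative. *)
have [O0|O_gt0] := posnP #|rotation_systems G|.
  rewrite O0 invr0 mulr0 mulr_ge0 // !addr_ge0 ?invr_ge0 // ?divr_ge0 ?mulr_ge0 ?exprn_ge0 //.
    by apply: sumr_ge0 => i _; rewrite invr_ge0.
  by rewrite addr_ge0 ?invr_ge0.
set B := (X in _ <= _ * X).
rewrite ler_pdivrMr ?ltr0n //.
under eq_bigr => rho _ do rewrite /num_faces card_porbits_sum.
rewrite exchange_big /= -mulrA mulr_natl -sumr_const.
apply: ler_sum => d _.
have q_neq0 : q%:R != 0 :> R by rewrite pnatr_eq0 -lt0n.
apply: le_trans (ler_sum _ (fun rho rot => inv_face_length d rot)) _.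
rewrite !big_split /= sumr_const -[_ *+ _]mulr_natr /B !mulrDl.
apply: lerD; first apply: lerD.
- by [].
  rewrite exchange_big /= -!mulrA mulr_suml; apply: ler_sum => i _.
  rewrite -mulr_sumr ler_wpM2l ?invr_ge0 //.
  rewrite ler_pdivlMl ?exprn_gt0 ?ltr0n // -natr_sum -natrX -natrM ler_nat.
  apply: leq_trans (card_closed_tame_walks min_degree d i); rewrite leq_mul2l; apply/orP; right.
  rewrite -sum1_card big_mkcond [X in (_ <= X)%N]big_mkcond; apply: leq_sum => rho _.
  by rewrite !inE /closed; case: (is_rotation_system rho) => //=; case: (_ && _).
rewrite exchange_big /=.
have -> : l%:R * #|vertex G|%:R * (1 + q%:R^-1) ^+ l / 2 ^+ k * #|rotation_systems G|%:R
  = \sum_(i < l) #|vertex G|%:R * (1 + q%:R^-1) ^+ l / 2 ^+ k * #|rotation_systems G|%:R :> R.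
  by rewrite sumr_const card_ord -[RHS]mulr_natl !mulrA.
apply: ler_sum => i _.
apply: le_trans (_ : #|vertex G|%:R * (1 + q%:R^-1) ^+ i.+1 / 2 ^+ k * #|rotation_systems G|%:R <= _).
  have -> : 1 + q%:R^-1 = q.+1%:R / q%:R :> R.
    by rewrite -[q.+1]addn1 natrD mulrDl divff // mul1r.
  have c_gt0 : 0 < 2 ^+ k * q%:R ^+ i.+1 :> R by rewrite mulr_gt0 ?exprn_gt0 ?ltr0n.
  rewrite -(ler_pM2l c_gt0) expr_div_n.
  rewrite (_ : _ * (_ / 2 ^+ k * _) = #|vertex G|%:R * q.+1%:R ^+ i.+1 * #|rotation_systems G|%:R);
    last by field; rewrite !expf_neq0 ?q_neq0 ?pnatr_eq0.
  rewrite -natr_sum -!natrX -!natrM ler_nat.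
  apply: leq_trans (card_wild_walks min_degree d i); rewrite leq_mul2l; apply/orP; right.
  rewrite -sum1_card big_mkcond [X in (_ <= X)%N]big_mkcond; apply: leq_sum => rho _.
  by rewrite !inE /wild; case: (is_rotation_system rho) => //=; case: (_ && _).
rewrite ler_wpM2r // ler_wpM2r ?invr_ge0 ?exprn_ge0 // ler_wpM2l //.
by rewrite ler_weXn2l // lerDl invr_ge0.
Qed.
End ShortFaces.

(** * Complete graphs and numerical estimates *)

Lemma card_darts_at_complete n (x : 'I_n) : #|@darts_at (complete_graph n) x| = n.-1.
Proof.
have inj : {in @darts_at (complete_graph n) x &, injective (@tgt (complete_graph n))}.
  move=> d e; rewrite !inE => /eqP dx /eqP ex; apply: dart_inj.
  by rewrite /src dx ex.
rewrite -(card_in_imset inj) (_ : _ @: _ = ~: [set x]).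
  by rewrite cardsC1 card_ord.
apply/setP=> y; rewrite !inE; apply/imsetP/idP => [[d]|yx].
  by rewrite inE => /eqP dx ->; rewrite -dx; apply: (tgt_neq_src d).
have xy : @adj (complete_graph n) x y by rewrite /= /neq_rel eq_sym.
by exists (exist _ (x, y) xy : dart (complete_graph n)) => //; rewrite inE.
Qed.

Lemma card_dart_complete n : #|dart (complete_graph n)| = (n * n.-1)%N.
Proof.
rewrite -sum1_card (partition_big (@src (complete_graph n)) xpredT) //=.
rewrite -[RHS](_ : \sum_(x : 'I_n) n.-1 = _)%N; last by rewrite sum_nat_const card_ord.
apply: eq_bigr => x _.
by rewrite -(card_darts_at_complete x) -sum1_card; apply: eq_bigl => d; rewrite inE.
Qed.

(** ln(1 - x) <= -x at x = 1/(l+2) gives 1/(l+2) <= ln(l+2) - ln(l+1). *)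
Lemma sum_inv_le_ln (R : realType) l : \sum_(i < l) i.+2%:R^-1 <= ln l.+1%:R :> R.
Proof.
elim: l => [|l IHl]; first by rewrite big_ord0 ln1.
rewrite big_ord_recr /= -lerBrDr; apply: le_trans IHl _.
have -> : l.+1%:R = l.+2%:R * (1 + - l.+2%:R^-1) :> R.
  by rewrite mulrDr mulr1 mulrN divff ?pnatr_eq0 // -[l.+2]addn1 natrD addrK.
rewrite lnM ?posrE ?ltr0n //.
  by rewrite lerD2l le_ln1Dx // ltrN2 invf_lt1 ?ltr0n // ltr1n.
by rewrite subr_gt0 invf_lt1 ?ltr0n // ltr1n.
Qed.

(** Bernoulli: (1 - 1/(q+1))^h >= 1 - h/(q+1) >= 1/2. *)
Lemma expn_succ_le_double q h : (2 * h <= q.+1)%N -> (q.+1 ^ h <= 2 * q ^ h)%N.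
Proof.
move=> hq.
have bernoulli j : (j <= q.+1)%N -> (q.+1 ^ j * (q.+1 - j) <= q.+1 * q ^ j)%N.
  elim: j => [|j IHj] jq; first by rewrite !expn0 subn0; lia.
  have := IHj (ltnW jq); rewrite !expnS => IH.
  have [b bE] : exists b, (q.+1 - j)%N = b.+1 by exists (q - j)%N; lia.
  rewrite (_ : q.+1 - j.+1 = b)%N; last by lia.
  have bq : (b <= q)%N by lia.
  rewrite bE in IH; nia.
rewrite -(leq_pmul2l (ltn0Sn q)).
have := bernoulli h; nia.
Qed.

Lemma wild_walk_odds_complete n : (4100 <= n)%N -> forall q k l,
  k = (n %/ 10)%N -> q = (n.-1 - 2 * k)%N -> l = (n * n.-1 %/ 40)%N ->
  (n * n.-1 * (l * n) * q.+1 ^ l <= q ^ l * 2 ^ k)%N.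
Proof.
move=> n_ge q k l kE qE lE.
(* Over [h] ~ 2n/5 steps the power at most doubles, and [t] ~ n/15 such blocks cover [l], as 2/75 >
   1/40. *)
pose h := (q.+1 %/ 2)%N; pose t := (n %/ 15).+1.
have lht : (l <= h * t)%N by rewrite /h /t; nia.
have pow_t : (q.+1 ^ (h * t) <= 2 ^ t * q ^ (h * t))%N.
  rewrite !expnM -expnMn leq_exp2r // expn_succ_le_double // /h; lia.
have pow_l : (q.+1 ^ l <= 2 ^ t * q ^ l)%N.
  have q_gt0 : (0 < q ^ (h * t - l))%N by rewrite expn_gt0; lia.
  rewrite -(leq_pmul2r q_gt0) -mulnA -expnD subnKC //; apply: leq_trans pow_t.
  rewrite -{2}(subnKC lht) expnD leq_mul2l; apply/orP; right.
  by case: (posnP (h * t - l)) => [->|e_gt0] //; rewrite leq_exp2r.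
pose j := (n %/ 400)%N.
have n_le : (n <= 2 ^ (9 + j))%N.
  rewrite expnD; apply: leq_trans (_ : 400 * j.+1 <= _)%N; first by rewrite /j; lia.
  by apply: leq_mul => //; exact: ltn_expl.
have n5 : (n * n.-1 * (l * n) <= 2 ^ ((9 + j) * 5))%N.
  rewrite expnM; apply: leq_trans (_ : n ^ 5 <= _)%N; last by rewrite leq_exp2r.
  have -> : (n ^ 5 = n * n * (n * n * n))%N by rewrite !expnS expn0; lia.
  have ln2 : (l <= n * n)%N by rewrite lE; nia.
  by apply: leq_mul; [rewrite leq_mul2l leq_pred orbT | rewrite leq_mul2r ln2 orbT].
apply: leq_trans (leq_mul n5 pow_l) _.
rewrite mulnA -expnD mulnC leq_mul2l leq_exp2l //; apply/orP; right.
rewrite /j /t kE; lia.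
Qed.

Lemma expected_num_faces_complete (R : realType) n : (4100 <= n)%N ->
  expected_num_faces R (complete_graph n) <= 32 / 10 * ln n%:R + 41.
Proof.
move=> n_ge; pose k := (n %/ 10)%N; pose q := (n.-1 - 2 * k)%N; pose l := (n * n.-1 %/ 40)%N.
have k_gt0 : (0 < k)%N by rewrite /k; lia.
have q_gt0 : (0 < q)%N by rewrite /q /k; lia.
have deg (x : vertex (complete_graph n)) : (q + 2 * k <= #|darts_at x|)%N.
  by rewrite (card_darts_at_complete x) /q /k; lia.
apply: le_trans (expected_num_faces_le R l k_gt0 q_gt0 deg) _.
rewrite card_dart_complete card_ord !mulrDr.
(* [a] bounds the long faces, [b] the short ones and [c] the walks with too many visits. *)
set a := _ * _^-1; set b := _ * (_ / _); set c := _ * (_ / _).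
have a_le : a <= 40.
  rewrite /a ler_pdivrMr ?ltr0n // -natrM ler_nat /l; lia.
have c_le : c <= 1.
  rewrite /c (_ : 1 + q%:R^-1 = q.+1%:R / q%:R); last first.
    by rewrite -[q.+1]addn1 natrD mulrDl divff ?mul1r ?pnatr_eq0 -?lt0n.
  rewrite expr_div_n mulrA ler_pdivrMr ?exprn_gt0 // mul1r !mulrA.
  rewrite ler_pdivrMr ?exprn_gt0 ?ltr0n // -!natrX -!natrM ler_nat.
  by rewrite -mulnA [X in (_ <= X)%N]mulnC mulnA -[(_ * l * n)%N]mulnA; exact: wild_walk_odds_complete.
have ln_n : 0 <= ln n%:R :> R by rewrite ln_ge0 // ler1n; lia.
have b_le : b <= 32 / 10 * ln n%:R.
  have sum_le : \sum_(i < l) i.+2%:R^-1 <= 2 * ln n%:R :> R.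
    apply: le_trans (sum_inv_le_ln R l) _.
    rewrite mulr_natl -lnXn ?ltr0n; last by lia.
    rewrite ler_ln ?posrE ?exprn_gt0 ?ltr0n //; last by lia.
    by rewrite -natrX ler_nat /l expnS expn1; nia.
  (* As q >= 8n/10 - 1, the ratio is about 1/0.64 = 1.5625; 1.6 leaves room for rounding. *)
  have ratio : (n * n.-1)%:R <= 16 / 10 * q%:R ^+ 2 :> R.
    rewrite -natrX mulrAC ler_pdivlMr // -!natrM ler_nat.
    have : (8 * n <= 10 * q + 10)%N by rewrite /q /k; lia.
    by rewrite expnS expn1; nia.
  rewrite /b mulrCA; apply: le_trans (_ : (2 * ln n%:R) * (16 / 10) <= _); last by lra.
  apply: ler_pM => //; first by apply: sumr_ge0 => i _; rewrite invr_ge0.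
    by rewrite divr_ge0 // exprn_ge0.
  by rewrite ler_pdivrMr // exprn_gt0 // ltr0n.
lra.
Qed.

Theorem theorem1p8 (R : realType) (n : nat) (n_gt0 : (0 < n)%N) :
  [/\ expR (expR 16) <= n%:R :> R ->
        expected_num_faces R (complete_graph n) <= 365 / 100 * ln n%:R,
      expR 30 <= n%:R :> R ->
        expected_num_faces R (complete_graph n) <= 5 * ln n%:R
    & (40748 <= n)%N -> n%:R < expR 30 :> R ->
        expected_num_faces R (complete_graph n) <= 10 * ln n%:R + 2].
Proof.
have exp_ge m (y : R) : m%:R <= y -> (2 ^ m)%:R <= expR y.
  move=> my; apply: (@le_trans _ _ (expR m%:R)); last by rewrite ler_expR.
  rewrite -[m%:R]mulr1 expRM_natl natrX lerXn2r ?nnegrE ?expR_ge0 //.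
  by apply: le_trans (expR_ge1Dx 1); lra.
have ln_ge x : expR x <= n%:R -> x <= ln n%:R :> R.
  by move=> xn; rewrite -[x]expRK ler_ln ?posrE ?expR_gt0 ?ltr0n.
have big : expR 30 <= n%:R :> R -> (4100 <= n)%N.
  move=> n30; rewrite -(ler_nat R); apply: le_trans n30.
  by apply: le_trans (exp_ge 13 _ _); [rewrite ler_nat | rewrite ler_nat].
have e16 : 128 <= expR 16 :> R by apply: (exp_ge 7); rewrite ler_nat.
split.
(* ln n >= 128, and 0.45 * 128 > 41. *)
- move=> n16; have ln16 := ln_ge _ n16.
  have n30 : expR 30 <= n%:R :> R by apply: le_trans n16; rewrite ler_expR; lra.
  have := expected_num_faces_complete R (big n30); lra.
(* ln n >= 30, and 1.8 * 30 > 41. *)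
- move=> n30; have := expected_num_faces_complete R (big n30); have := ln_ge _ n30; lra.
- move=> n_ge _; have n_ge' : (4100 <= n)%N by apply: leq_trans n_ge.
  have := expected_num_faces_complete R n_ge'.
  (* With n >= 2^12 this gives ln n >= 6, and 6.8 * 6 > 39 = 41 - 2. *)
  have ln2 : 1 / 2 <= ln 2 :> R.
    have : ln (1 + - (1 / 2)) <= - (1 / 2) :> R by apply: le_ln1Dx; lra.
    by rewrite (_ : 1 + - (1 / 2) = 2^-1 :> R) ?lnV ?posrE //; lra.
  have : ln (2 ^+ 12) <= ln n%:R :> R.
    rewrite ler_ln ?posrE ?exprn_gt0 ?ltr0n // -natrX ler_nat.
    by apply: leq_trans n_ge'.
  rewrite lnXn // -[ln 2 *+ 12]mulr_natr; lra.
Qed.
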